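(* Let $\mathcal M=(Q,A,\tau,\sigma)$ be the Mealy automaton with $Q=\{0,1,2\}$, $A=\{0,1\}$, where for $a\in Q$ and $x\in A$ the values $y=\sigma(a,x)\in A$ and $b=\tau(a,x)\in Q$ are the unique elements satisfying the integer equation $a+3y=x+2b$. Then for every $m\ge 1$ the map $\boldsymbol\tau_0$ has an orbit in $Q^m$ of size $2\cdot 3^{m-1}$, and $\operatorname{diam}(\Gamma_{\mathcal M,n})=O(n^2)$; however, the family of Schreier graphs $\{\Gamma_{\mathcal M,n}\}_{n=1}^\infty$ is not a family of expanders.
   Context: A Mealy automaton $\mathcal M=(Q,A,\tau,\sigma)$ consists of finite sets $Q$ (states) and $A$ (alphabet) and functions $\sigma:Q\times A\to A$ (output) and $\tau:Q\times A\to Q$ (transition). For $q\in Q$, the length-preserving map $\boldsymbol\sigma_q$ on finite words over $A$ is defined recursively by $\boldsymbol\sigma_q(\emptyset)=\emptyset$ and $\boldsymbol\sigma_q(x_0x_1\dots x_n)=y_0\,\boldsymbol\sigma_r(x_1\dots x_n)$, where $y_0=\sigma(q,x_0)$ and $r=\tau(q,x_0)$. For $x\in A$, the length-preserving map $\boldsymbol\tau_x:Q^*\to Q^*$ is defined recursively by $\boldsymbol\tau_x(\emptyset)=\emptyset$ and $\boldsymbol\tau_x(vq)=\boldsymbol\tau_y(v)\,r$ for $v\in Q^*$, $q\in Q$, where $y=\sigma(q,x)$ and $r=\tau(q,x)$. The Schreier graph $\Gamma_{\mathcal M,n}$ is the directed graph (self-loops and repeated edges allowed) with vertex set $A^n$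 and one edge $s\to\boldsymbol\sigma_q(s)$ for each $s\in A^n$ and each $q\in Q$. Distances in a graph are lengths of shortest undirected paths, and the diameter is the maximum distance between two vertices. A sequence of finite graphs of bounded degree is a family of expanders if there is $\varepsilon>0$ such that for every graph $\Gamma$ in the sequence and every nonempty set $S$ of at most half of its vertices, the number of edges (ignoring direction) between $S$ and its complement is at least $\varepsilon|S|$. *)

(* Defs.v *)
From HB Require Import structures.
From mathcomp Require Import all_boot all_order all_algebra.
From mathcomp Require Import reals.
From mathcomp Require Import zify.

Set Implicit Arguments.
Unset Strict Implicit.
Unset Printing Implicit Defensive.

Import Order.TTheory GRing.Theory Num.Theory.

(** ** Mealy automata *)

Record mealy := Mealy {
  state : finType;
  letter : finType;
  output : state -> letter -> letter;
  transition : state -> letter -> state }.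

Fixpoint sigma_word (M : mealy) (q : state M) (s : seq (letter M)) :
    seq (letter M) :=
  if s is x :: s' then output q x :: sigma_word (transition q x) s' else [::].

Fixpoint tau_rev (M : mealy) (x : letter M) (w : seq (state M)) :
    seq (state M) :=
  if w is q :: w' then transition q x :: tau_rev (output q x) w' else [::].

(* Words over the states are read from right to left; [tau_word_rcons] is the
   usual recursive equation. *)
Definition tau_word (M : mealy) (x : letter M) (w : seq (state M)) :
    seq (state M) := rev (tau_rev x (rev w)).

Lemma tau_word_nil (M : mealy) (x : letter M) : tau_word x [::] = [::].
Proof. by []. Qed.

Lemma tau_word_rcons (M : mealy) (x : letter M) (v : seq (state M))
    (q : state M) :
  tau_word x (rcons v q) = rcons (tau_word (output q x) v) (transition q x).
Proof. by rewrite /tau_word rev_rcons /= rev_cons. Qed.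

Lemma size_sigma_word (M : mealy) (q : state M) (s : seq (letter M)) :
  size (sigma_word q s) = size s.
Proof. by elim: s q => //= x s IHs q; rewrite IHs. Qed.

Lemma size_tau_word (M : mealy) (x : letter M) (w : seq (state M)) :
  size (tau_word x w) = size w.
Proof.
by elim/last_ind: w x => // w q IHw x; rewrite tau_word_rcons !size_rcons IHw.
Qed.

Lemma sigma_tupleP (M : mealy) (n : nat) (q : state M) (s : n.-tuple (letter M)) :
  size (sigma_word q s) == n.
Proof. by rewrite size_sigma_word size_tuple. Qed.

Lemma tau_tupleP (M : mealy) (m : nat) (x : letter M) (w : m.-tuple (state M)) :
  size (tau_word x w) == m.
Proof. by rewrite size_tau_word size_tuple. Qed.

Definition sigma_tuple (M : mealy) (n : nat) (q : state M)
    (s : n.-tuple (letter M)) : n.-tuple (letter M) := Tuple (sigma_tupleP q s).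

Definition tau_tuple (M : mealy) (m : nat) (x : letter M)
    (w : m.-tuple (state M)) : m.-tuple (state M) := Tuple (tau_tupleP x w).

(** ** Finite directed multigraphs *)

Record multigraph := Multigraph {
  vertex : finType;
  edge : finType;
  src : edge -> vertex;
  tgt : edge -> vertex }.

Definition adj (G : multigraph) : rel (vertex G) := fun u v =>
  [exists e : edge G, ((src e == u) && (tgt e == v)) ||
                      ((src e == v) && (tgt e == u))].

(* The vertices of the path are [u :: p]; its length is [size p]. *)
Definition has_path (G : multigraph) (u v : vertex G) (k : nat) : Prop :=
  exists p : seq (vertex G), [/\ path (@adj G) u p, last u p = v & size p = k].

Definition is_dist (G : multigraph) (u v : vertex G) (d : nat) : Prop :=
  has_path u v d /\ (forall k : nat, has_path u v k -> d <= k).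

(* No [D] satisfies this when [G] is disconnected: its diameter is infinite. *)
Definition is_diam (G : multigraph) (D : nat) : Prop :=
  (forall u v : vertex G, exists2 d : nat, is_dist u v d & d <= D) /\
  (exists u v : vertex G, is_dist u v D).

Definition edge_boundary (G : multigraph) (S : {set vertex G}) : {set edge G} :=
  [set e : edge G | (src e \in S) (+) (tgt e \in S)].

(* A self-loop counts twice. *)
Definition degree (G : multigraph) (v : vertex G) : nat :=
  #|[set e : edge G | src e == v]| + #|[set e : edge G | tgt e == v]|.

Definition bounded_degree (G : nat -> multigraph) : Prop :=
  exists d : nat, forall (n : nat) (v : vertex (G n)), degree v <= d.

(* Meant for families satisfying [bounded_degree]. *)
Definition expander_family (R : realType) (G : nat -> multigraph) : Prop :=
  exists2 eps : R, (0 < eps)%R &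
    forall (n : nat) (S : {set vertex (G n)}),
      S != set0 -> 2 * #|S| <= #|vertex (G n)| ->
      (eps * #|S|%:R <= #|edge_boundary S|%:R)%R.

(** ** Schreier graphs *)

Definition schreier (M : mealy) (n : nat) : multigraph :=
  @Multigraph (n.-tuple (letter M)) (n.-tuple (letter M) * state M)%type
    (fun e => e.1) (fun e => sigma_tuple e.2 e.1).

(** ** The automaton defined by [a + 3 y = x + 2 b] *)

Lemma step_exists (a : 'I_3) (x : 'I_2) :
  exists yb : 'I_2 * 'I_3, a + 3 * yb.1 == x + 2 * yb.2.
Proof.
have ha := ltn_ord a; have hx := ltn_ord x.
have hy : (a + x) %% 2 < 2 by lia.
have hb : (a + 3 * ((a + x) %% 2) - x) %/ 2 < 3 by lia.
by exists (Ordinal hy, Ordinal hb); apply/eqP => /=; lia.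
Qed.

Definition step (a : 'I_3) (x : 'I_2) : 'I_2 * 'I_3 := xchoose (step_exists a x).

Definition M3 : mealy :=
  @Mealy 'I_3 'I_2 (fun a x => (step a x).1) (fun a x => (step a x).2).

Lemma M3_unique (a : 'I_3) (x y : 'I_2) (b : 'I_3) :
  a + 3 * y = x + 2 * b <->
  y = @output M3 a x /\ b = @transition M3 a x.
Proof.
rewrite /= /step; have /eqP := xchooseP (step_exists a x).
move: (xchoose _) => [y' b'] /= E'; split=> [E | [-> ->] //].
have := ltn_ord y; have := ltn_ord y'.
by move=> ? ?; split; apply: val_inj => /=; lia.
Qed.

Lemma sigma_word_M3_inj (q : state M3) : injective (sigma_word q).
Proof.
move=> s t; elim: s t q => [|x s IHs] [|z t] q // [Eo Es].
have {}Eo : x = z.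
  have [_ /(_ (conj erefl erefl)) Ex] :=
    M3_unique q x (@output M3 q x) (@transition M3 q x).
  have [_ /(_ (conj erefl erefl)) Ez] :=
    M3_unique q z (@output M3 q z) (@transition M3 q z).
  have := congr1 val Eo; have := ltn_ord x; have := ltn_ord z.
  by move: Ex Ez => /= *; apply: val_inj => /=; lia.
by rewrite Eo in Es *; rewrite (IHs _ _ Es).
Qed.

Lemma schreier_M3_bounded_degree : bounded_degree (schreier M3).
Proof.
exists 6 => n v; rewrite /degree (_ : 6 = 3 + 3) //.
have inj2 (E : {set edge (schreier M3 n)}) :
    {in E &, injective (fun e : edge (schreier M3 n) => e.2)} -> #|E| <= 3.
  by move=> /card_in_imset <-; rewrite -[3]card_ord max_card.
apply: leq_add; apply: inj2 => -[s q] [t r]; rewrite !inE /=.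
  by move=> /eqP-> /eqP-> ->.
move=> /eqP Es /eqP Et Eqr; move: Et; rewrite -Es -Eqr => /(congr1 val) /=.
by move=> /sigma_word_M3_inj /val_inj ->.
Qed.

(* Main.v *)
Require Import Defs.
From mathcomp Require Import all_boot all_order all_algebra cyclic.
From mathcomp Require Import reals.
From mathcomp Require Import zify ring.

(** Everything follows from reading words as numbers, least significant digit
    first. Summing the equations [a + 3 y = x + 2 b] along a run shows that
    [sigma_q] acts on words of length [n] as [X |-> (X - q) / 3] on the integers
    modulo [2 ^ n] ([sigma_value]), while [tau_0] acts on words of length [m] as
    [W |-> W / 2] on the integers modulo [3 ^ m] ([tau_value]).

    Orbit: the orbit of [W = 1] under halving has as many elements as the order
    of [2] modulo [3 ^ m], which is [2 * 3 ^ (m - 1)]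
    ([pow2_period], [pow2_order]).

    Diameter: up to orientation, the edges of the Schreier graph join [k] to
    [3 k], [3 k + 1] and [3 k + 2]. By ternary expansion, [n] such moves lead
    from [k] to every [3 ^ n k + r] with [r < 3 ^ n], hence to every residue
    modulo [2 ^ n] ([path_to_translate]). The diameter is thus at most [n], which
    is better than quadratic.

    Expansion: the maps [k |-> 3 k + a] generate a solvable, hence amenable, group
    of affine maps, and a Folner set of that group pushed into the graph gives a
    set of small boundary. Explicitly, the set is
    [{ 3 ^ -(K + 1) * 3 ^ j * (N + i) : j <= K, i < N }] modulo [2 ^ n], where [N]
    is much larger than [3 ^ K]. The move [k |-> 3 k + q] raises [j] by one and
    shifts [i] by at most [2 * 3 ^ K], so it leaves the set only from the last
    layer [j = K] or from the end of a layer ([folner_set_step]). When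
    [N = 2 (K + 1) 3 ^ K] the set has [(K + 1) N] elements and at most [12 N]
    boundary edges, and [K] is arbitrary
    ([card_folner_set], [folner_set_boundary]). *)

Set Implicit Arguments.
Unset Strict Implicit.
Unset Printing Implicit Defensive.

(** * Words as numbers *)

Fixpoint digits_value (b : nat) (s : seq 'I_b) : nat :=
  if s is d :: s' then d + b * digits_value s' else 0.

Fixpoint digits (b n k : nat) : seq 'I_b.+1 :=
  if n is n'.+1 then inord (k %% b.+1) :: digits b n' (k %/ b.+1) else [::].

Lemma digits_value_lt (b : nat) (s : seq 'I_b) : digits_value s < b ^ size s.
Proof.
elim: s => //= d s IHs; rewrite expnS.
apply: (@leq_trans (b * (digits_value s).+1)); last by rewrite leq_mul2l IHs orbT.
by rewrite mulnS ltn_add2r.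
Qed.

Lemma digits_value_inj (b : nat) (s t : seq 'I_b) :
  size s = size t -> digits_value s = digits_value t -> s = t.
Proof.
elim: s t => [|d s IHs] [|e t] //= [Esz] E.
have b_gt0 : 0 < b by apply: leq_trans (ltn_ord d).
have Ed : (d : nat) = e.
  have := congr1 (modn^~ b) E.
  by rewrite /= ![_ + b * _]addnC ![b * _]mulnC !modnMDl !modn_small ?ltn_ord.
rewrite (val_inj Ed) (IHs t) //.
by move: E; rewrite Ed => /addnI /eqP; rewrite eqn_pmul2l // => /eqP.
Qed.

Lemma size_digits (b n k : nat) : size (digits b n k) == n.
Proof. by elim: n k => //= n IHn k; rewrite eqSS IHn. Qed.

Lemma digitsK (b n k : nat) : digits_value (digits b n k) = k %% b.+1 ^ n.
Proof.
elim: n k => [|n IHn] k /=; first by rewrite modn1.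
rewrite inordK ?ltn_mod // IHn.
set P := b.+1 ^ n; set l := k %/ b.+1.
rewrite [in RHS](divn_eq k b.+1) -/l [in RHS](divn_eq l P) expnS -/P.
rewrite (_ : _ * b.+1 + _ =
  l %/ P * (b.+1 * P) + (k %% b.+1 + b.+1 * (l %% P))); last by ring.
rewrite modnMDl [in RHS]modn_small //.
apply: (@leq_trans (b.+1 * (l %% P).+1)); first by rewrite mulnS ltn_add2r ltn_mod.
by rewrite leq_mul2l ltn_mod expn_gt0 orbT.
Qed.

(** * The automaton as arithmetic *)

Lemma M3_stepE (a : 'I_3) (x : 'I_2) :
  a + 3 * @output M3 a x = x + 2 * @transition M3 a x :> nat.
Proof. by apply/M3_unique. Qed.

Lemma sigma_value (q : 'I_3) (s : seq 'I_2) :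
  digits_value s = q + 3 * digits_value (@sigma_word M3 q s) %[mod 2 ^ size s].
Proof.
(* The excess over the congruence is the carry: the state that ends the run. *)
suff [b ->] : exists b : nat,
    q + 3 * digits_value (@sigma_word M3 q s) = digits_value s + 2 ^ size s * b.
  by rewrite addnC mulnC modnMDl.
elim: s q => [|x s IHs] q; first by exists q; rewrite muln0 addn0 mul1n.
have [b Eb] := IHs (@transition M3 q x); exists b.
have E := M3_stepE q x.
set y := @sigma_word M3 _ s in Eb.
rewrite /= -/y expnS; move: Eb E.
set r := nat_of_ord (@transition M3 q x).
change (nat_of_ord (step q x).1) with (nat_of_ord (@output M3 q x)).
nia.
Qed.

Lemma tau_value (x : 'I_2) (w : seq 'I_3) :
  digits_value w = x + 2 * digits_value (@tau_rev M3 x w) %[mod 3 ^ size w].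
Proof.
(* The carry is now the last letter emitted. *)
suff [y <-] : exists y : nat,
    digits_value w + 3 ^ size w * y = x + 2 * digits_value (@tau_rev M3 x w).
  by rewrite addnC mulnC modnMDl.
elim: w x => [|q w IHw] x; first by exists x; rewrite muln0 addn0 mul1n.
have [y Ey] := IHw (@output M3 q x); exists y.
have E := M3_stepE q x.
set v := @tau_rev M3 _ w in Ey.
rewrite /= -/v expnS; move: Ey E.
change (nat_of_ord (step q x).2) with (nat_of_ord (@transition M3 q x)).
nia.
Qed.

(** * The order of 2 modulo a power of 3 *)

(** The order of [4] modulo [9] is [3]. *)
Lemma pow4_mod9 (e : nat) : 9 %| 4 ^ e - 1 -> 3 %| e.
Proof.
rewrite -eqn_mod_dvd ?expn_gt0 // {1}(divn_eq e 3) mulnC expnD expnM.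
rewrite -modnMml -modnXm exp1n modnMml mul1n /dvdn.
by have := ltn_pmod e (isT : 0 < 3); case: (e %% 3) => [|[|[|]]].
Qed.

(** Lifting the exponent. Once [e = 3 f], put [4 ^ f = 1 + 3 u]: then
    [4 ^ e - 1 = (4 ^ f - 1) * 3 * (1 + 3 (u + u ^ 2))], whose last factor is prime
    to [3], so that exactly one power of [3] is lost in passing from [e] to [f]. *)
Lemma pow4_sub1_dvd (m e : nat) : 3 ^ m.+1 %| 4 ^ e - 1 -> 3 ^ m %| e.
Proof.
elim: m e => [|m IHm] e; first by rewrite dvd1n.
move=> H.
have /dvdnP[f Ef] : 3 %| e.
  by apply: pow4_mod9; apply: dvdn_trans H; rewrite !expnS mulnA dvdn_mulr.
rewrite Ef expnSr dvdn_pmul2r //; apply: IHm.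
have : 1 = 4 ^ f %[mod 3] by rewrite -modnXm exp1n.
move/esym/eqP; rewrite eqn_mod_dvd ?expn_gt0 // => /dvdnP[u Eu].
have E4 : 4 ^ f = 1 + 3 * u by have := expn_gt0 4 f; lia.
move: H; rewrite Ef expnM E4.
have -> : (1 + 3 * u) ^ 3 - 1 = (1 + 3 * u - 1) * (1 + 3 * (u + u ^ 2)) * 3.
  by rewrite addKn; apply/eqP; rewrite -(eqn_add2l 1) subnKC ?expn_gt0 //; apply/eqP; ring.
rewrite expnSr dvdn_pmul2r // Gauss_dvdl // coprimeXl //.
by rewrite addnC /coprime mulnC gcdnMDl.
Qed.

(** Modulo [3] the exponent [d] must be even, so this is a statement about the
    powers of [4]. *)
Lemma pow2_order (m d : nat) :
  2 ^ d = 1 %[mod 3 ^ m.+1] -> 2 * 3 ^ m %| d.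
Proof.
move/eqP; rewrite eqn_mod_dvd ?expn_gt0 // => D.
have Ed : d = d./2 * 2.
  have : 2 ^ d = 1 %[mod 3].
    apply/eqP; rewrite eqn_mod_dvd ?expn_gt0 //.
    by apply: dvdn_trans D; rewrite expnS dvdn_mulr.
  rewrite -{1}(odd_double_half d) -mul2n expnD expnM -modnMmr -modnXm exp1n modnMmr.
  by have := odd_double_half d; case: (odd d) => //= E _; lia.
rewrite Ed mulnC dvdn_pmul2r //; apply: pow4_sub1_dvd.
by rewrite -(expnM 2 2) mulnC -Ed.
Qed.

Lemma pow2_period (m : nat) : 2 ^ (2 * 3 ^ m) = 1 %[mod 3 ^ m.+1].
Proof.
have /Euler_exp_totient : coprime 2 (3 ^ m.+1) by rewrite coprimeXr.
by rewrite totient_pfactor.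
Qed.

Lemma order_eq_period (T : finType) (f : T -> T) (x : T) (N : nat) :
  injective f -> 0 < N -> iter N f x = x ->
  (forall d, iter d f x = x -> N %| d) -> order f x = N.
Proof.
move=> f_inj N_gt0 EN minN; apply/eqP; rewrite eqn_leq; apply/andP; split.
  have cyc : fcycle f (traject f x N).
    case: N N_gt0 EN {minN} => // N _ EN.
    by rewrite /= rcons_path fpath_traject last_traject /= -iterS EN eqxx.
  rewrite -[leqRHS](size_traject f x).
  by apply: order_le_cycle => //; case: N N_gt0 {EN minN cyc} => // N _; apply: mem_head.
by apply: dvdn_leq; [apply: order_gt0 | apply/minN/iter_order].
Qed.

(** [tau_word] reads its word from right to left, so the rightmost state is the
    least significant ternary digit. *)
Definition value3 (m : nat) (w : m.-tuple (state M3)) : nat :=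
  @digits_value 3 (rev w).

Lemma value3_inj (m : nat) (w w' : m.-tuple (state M3)) :
  value3 w = value3 w' %[mod 3 ^ m] -> w = w'.
Proof.
have lt (v : m.-tuple (state M3)) : value3 v < 3 ^ m.
  by rewrite -{2}(size_tuple v) -size_rev; apply: digits_value_lt.
rewrite !modn_small // => /digits_value_inj E; apply: val_inj.
by apply: (can_inj revK); apply: E; rewrite !size_rev !size_tuple.
Qed.

Lemma value3_tau (m : nat) (w : m.-tuple (state M3)) :
  value3 w = 2 * value3 (@tau_tuple M3 m (ord0 : 'I_2) w) %[mod 3 ^ m].
Proof.
rewrite /value3 /= /tau_word revK.
by have := tau_value ord0 (rev w); rewrite size_rev size_tuple.
Qed.

Lemma value3_iter_tau (m d : nat) (w : m.-tuple (state M3)) :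
  value3 w = 2 ^ d * value3 (iter d (@tau_tuple M3 m (ord0 : 'I_2)) w) %[mod 3 ^ m].
Proof.
elim: d => [|d IHd]; first by rewrite mul1n.
by rewrite IHd -modnMmr value3_tau modnMmr mulnA -expnSr.
Qed.

Lemma tau0_orbit (m : nat) : exists w : m.+1.-tuple (state M3),
  order (@tau_tuple M3 m.+1 (ord0 : 'I_2)) w = 2 * 3 ^ m.
Proof.
have sz : size (rev (digits 2 m.+1 1)) == m.+1 by rewrite size_rev size_digits.
exists (Tuple (sz : size (rev (digits 2 m.+1 1) : seq (state M3)) == m.+1)).
set w := Tuple _.
have Ew : value3 w = 1 %[mod 3 ^ m.+1].
  by rewrite /value3 /w /= revK (digitsK 2 m.+1) modn_mod.
apply: order_eq_period.
- move=> v v' Evv; apply: value3_inj.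
  by rewrite value3_tau Evv -value3_tau.
- by rewrite muln_gt0 expn_gt0.
- apply: value3_inj; symmetry.
  by rewrite (value3_iter_tau (2 * 3 ^ m)) -modnMml pow2_period modnMml mul1n.
- move=> d Ed; apply: pow2_order.
  have := value3_iter_tau d w.
  by rewrite Ed -modnMmr Ew modnMmr muln1 => ->.
Qed.

(** * Schreier graphs on the integers modulo a power of 2 *)

Definition vert (n k : nat) : vertex (schreier M3 n) :=
  Tuple (size_digits 1 n k).

Definition value2 (n : nat) (s : vertex (schreier M3 n)) : nat :=
  @digits_value 2 s.

Lemma vertK n k : value2 (vert n k) = k %% 2 ^ n.
Proof. exact: digitsK. Qed.

Lemma value2_lt n (s : vertex (schreier M3 n)) : value2 s < 2 ^ n.
Proof. by have := digits_value_lt (s : seq 'I_2); rewrite size_tuple. Qed.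

Lemma value2_inj n : injective (@value2 n).
Proof.
move=> s t /digits_value_inj E; apply: val_inj; apply: E.
by rewrite !size_tuple.
Qed.

Lemma value2K n : cancel (@value2 n) (vert n).
Proof.
by move=> s; apply: value2_inj; rewrite vertK modn_small ?value2_lt.
Qed.

Lemma vert_eqP n k k' : vert n k = vert n k' <-> k = k' %[mod 2 ^ n].
Proof.
split=> [E | E]; first by rewrite -!vertK E.
by apply: value2_inj; rewrite !vertK.
Qed.

Lemma card_schreier n : #|vertex (schreier M3 n)| = 2 ^ n.
Proof. by rewrite card_tuple card_ord. Qed.

Lemma vert_sigma n (q : state M3) (s : vertex (schreier M3 n)) :
  s = vert n (3 * value2 (sigma_tuple q s : vertex (schreier M3 n)) + (q : 'I_3)).
Proof.
apply: value2_inj; rewrite vertK addnC /value2.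
have := sigma_value q (s : seq 'I_2); rewrite size_tuple => <-.
by rewrite modn_small //; apply: value2_lt.
Qed.

Lemma modn_cancel (p d k l : nat) :
  coprime p d -> p * k = p * l %[mod d] -> k = l %[mod d].
Proof.
move=> co; wlog le_lk : k l / l <= k.
  move=> H; case/orP: (leq_total l k) => le; first exact: H.
  by move/esym => E; symmetry; apply: H.
move=> /eqP; rewrite eqn_mod_dvd ?leq_mul2l ?le_lk ?orbT // -mulnBr.
rewrite Gauss_dvdr; last by rewrite coprime_sym.
by rewrite -eqn_mod_dvd // => /eqP.
Qed.

Lemma sigma_vert n (q : 'I_3) k :
  @sigma_tuple M3 n q (vert n (3 * k + q)) = vert n k.
Proof.
set s := vert n _; set t := sigma_tuple _ _.
have E : s = vert n (3 * value2 (t : vertex (schreier M3 n)) + q).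
  exact: vert_sigma.
apply: (can_inj (@value2K n)); rewrite vertK.
rewrite -(modn_small (value2_lt (t : vertex (schreier M3 n)))).
apply: (@modn_cancel 3); first by rewrite coprimeXr.
by apply/eqP; rewrite -(eqn_modDr q); apply/eqP/esym/vert_eqP.
Qed.

(** * Diameter *)

(** A boolean form of [has_path], so that minimal lengths can be extracted. *)
Definition path_of_size (G : multigraph) (u v : vertex G) (k : nat) : bool :=
  [exists p : k.-tuple (vertex G), path (@adj G) u p && (last u p == v)].

Lemma has_pathP (G : multigraph) (u v : vertex G) (k : nat) :
  reflect (has_path u v k) (path_of_size u v k).
Proof.
apply: (iffP existsP) => [[p /andP[Hp /eqP Ep]] | [p [Hp Ep /eqP Hk]]].
  by exists p; rewrite size_tuple.
by exists (Tuple Hk); rewrite Hp Ep eqxx.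
Qed.

Lemma dist_exists (G : multigraph) (u v : vertex G) (k : nat) :
  has_path u v k -> exists2 d : nat, is_dist u v d & d <= k.
Proof.
move/has_pathP => Hk; have ex : exists k, path_of_size u v k by exists k.
case: (ex_minnP ex) => d /has_pathP Hd mind.
exists d; last exact: mind.
by split=> // l /has_pathP; apply: mind.
Qed.

Lemma dist_unique (G : multigraph) (u v : vertex G) (d d' : nat) :
  is_dist u v d -> is_dist u v d' -> d = d'.
Proof.
move=> [Hd mind] [Hd' mind']; apply/eqP.
by rewrite eqn_leq mind // mind'.
Qed.

(** A finite graph in which any two vertices are joined by a path has a
    diameter; it is bounded by any bound on the lengths of such paths. *)
Lemma diam_exists (G : multigraph) (u0 : vertex G) (n : nat) :
  (forall u v : vertex G, exists2 k : nat, has_path u v k & k <= n) ->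
  exists2 D : nat, is_diam G D & D <= n.
Proof.
move=> conn.
have dist (u v : vertex G) : exists2 d : nat, is_dist u v d & d <= n.
  have [k Hk le_kn] := conn u v; have [d Hd le_dk] := dist_exists Hk.
  by exists d => //; apply: leq_trans le_kn.
pose isd (u v : vertex G) d := path_of_size u v d && [forall k : 'I_d, ~~ @path_of_size G u v k].
have isdP (u v : vertex G) d : reflect (is_dist u v d) (isd u v d).
  apply: (iffP andP) => [[/has_pathP Hd /forallP mind] | [/has_pathP Hd mind]].
    split=> // k /has_pathP Hk; rewrite leqNgt; apply/negP => lt.
    by have := mind (Ordinal lt); rewrite Hk.
  split=> //; apply/forallP => k; apply/negP => /has_pathP /mind.
  by rewrite leqNgt ltn_ord.
pose P d := [exists u, exists v, isd u v d].
have PP d : reflect (exists u v : vertex G, is_dist u v d) (P d).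
  apply: (iffP existsP) => [[u /existsP[v /isdP H]] | [u [v /isdP H]]].
    by exists u, v.
  by exists u; apply/existsP; exists v.
have exP : exists d, P d.
  by have [d Hd _] := dist u0 u0; exists d; apply/PP; exists u0, u0.
have leP d : P d -> d <= n.
  move/PP => [u [v Hd]]; have [d' Hd' le] := dist u v.
  by rewrite (dist_unique Hd Hd').
case: (ex_maxnP exP leP) => D PD maxD; exists D; last exact: leP.
split; last exact/PP.
move=> u v; have [d Hd _] := dist u v; exists d => //.
by apply: maxD; apply/PP; exists u, v.
Qed.

Lemma adj_vert n k (q : 'I_3) : adj (vert n k) (vert n (3 * k + q)).
Proof.
apply/existsP; exists (vert n (3 * k + q), q : state M3).
by rewrite /= (sigma_vert n q k) !eqxx orbT.
Qed.

(** The moves add the ternary digits of [r], the most significant one first. *)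
Lemma path_to_translate n m k r :
  r < 3 ^ m -> has_path (vert n k) (vert n (3 ^ m * k + r)) m.
Proof.
elim: m k r => [|m IHm] k r.
  by rewrite ltnS leqn0 => /eqP->; exists [::]; rewrite mul1n addn0.
rewrite expnS => lt_r.
(* The first move adds the leading digit of [r]. *)
have lt_q : r %/ 3 ^ m < 3 by rewrite ltn_divLR ?expn_gt0.
have [p [Hp Ep Sp]] := IHm (3 * k + Ordinal lt_q) _ (ltn_pmod r (expn_gt0 3 m)).
exists (vert n (3 * k + Ordinal lt_q) :: p); split.
- by rewrite /= (adj_vert n k (Ordinal lt_q)).
- rewrite [LHS]Ep; congr vert; rewrite [in RHS](divn_eq r (3 ^ m)) /=; ring.
- by rewrite /= Sp.
Qed.

Lemma short_path n (u v : vertex (schreier M3 n)) : has_path u v n.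
Proof.
pose k := value2 u; pose x := 3 ^ n * k.
(* The representative of [v - 3 ^ n u] in [0, 2 ^ n). *)
pose r := (value2 v + (2 ^ n - x %% 2 ^ n)) %% 2 ^ n.
have lt_r : r < 3 ^ n.
  apply: (@leq_trans (2 ^ n)); first by rewrite ltn_mod expn_gt0.
  by case: n {u v k x r} => // n; rewrite leq_exp2r.
have := path_to_translate n k lt_r; rewrite /k value2K.
suff -> : vert n (3 ^ n * k + r) = v by [].
apply: value2_inj; rewrite vertK -/x /r modnDmr.
have lt : x %% 2 ^ n < 2 ^ n by rewrite ltn_mod expn_gt0.
rewrite addnCA {1}(divn_eq x (2 ^ n)) -addnA (subnKC (ltnW lt)) addnC.
by rewrite -mulSnr modnMDl modn_small ?value2_lt.
Qed.

Lemma schreier_diam n : exists2 D : nat, is_diam (schreier M3 n) D & D <= n.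
Proof.
apply: (diam_exists (vert n 0)) => u v; exists n => //.
exact: short_path.
Qed.

(** * Almost invariant sets *)

(** Each state acts on the vertices by a permutation, so as many edges start in
    [S] as end in [S]; hence as many edges leave [S] as enter it. *)
Lemma card_edge_boundary n (S : {set vertex (schreier M3 n)}) :
  #|edge_boundary S| =
  2 * #|[set e : edge (schreier M3 n) | (tgt e \in S) && (src e \notin S)]|.
Proof.
pose A := [set e : edge (schreier M3 n) | src e \in S].
pose B := [set e : edge (schreier M3 n) | tgt e \in S].
have EAB : #|B| = #|A|.
  pose h (e : edge (schreier M3 n)) : edge (schreier M3 n) := (sigma_tuple e.2 e.1, e.2).
  have <- : h @^-1: A = B by apply/setP => e; rewrite !inE.
  apply: card_preimset => -[s q] [t r] [] /= E Eqr; move: E; rewrite -Eqr.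
  by move=> E; congr pair; apply: val_inj; apply: (@sigma_word_M3_inj q).
have -> : [set e : edge (schreier M3 n) | (tgt e \in S) && (src e \notin S)] = B :\: A.
  by apply/setP => e; rewrite !inE andbC.
have -> : edge_boundary S = (A :\: B) :|: (B :\: A).
  by apply/setP => e; rewrite !inE; case: (src e \in S); case: (tgt e \in S).
rewrite cardsU (_ : _ :&: _ = set0); last first.
  by apply/setP => e; rewrite !inE; case: (src e \in S); case: (tgt e \in S).
by rewrite cards0 subn0 !cardsD EAB (setIC B) mul2n addnn.
Qed.

(** Meant for an inverse [c] of [3 ^ K.+1] modulo [2 ^ n]: the value is then
    [3 ^ (j - K - 1) * (N + i)], where [p = (j, i)]. *)
Definition folner_value (c K N : nat) (p : 'I_K.+1 * 'I_N) : nat :=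
  c * (3 ^ p.1 * (N + p.2)).

Definition folner_set (n c K N : nat) : {set vertex (schreier M3 n)} :=
  [set vert n (folner_value c p) | p : 'I_K.+1 * 'I_N].

(** The layers, indexed by [p.1 = j], lie in the intervals
    [[3 ^ j * N, 3 ^ j * 2 N)], which are pairwise disjoint because [2 < 3]. *)
Lemma folner_integers_inj (K N : nat) :
  injective (fun p : 'I_K.+1 * 'I_N => 3 ^ p.1 * (N + p.2)).
Proof.
have lt (j j' i i' : nat) : i < N -> j < j' -> 3 ^ j * (N + i) < 3 ^ j' * (N + i').
  move=> lt_i lt_j; apply: (@leq_trans (3 ^ j.+1 * (N + i'))).
    by rewrite expnSr -mulnA ltn_pmul2l ?expn_gt0 //; lia.
  by rewrite leq_mul2r leq_exp2l // lt_j orbT.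
move=> [j i] [j' i'] /= E.
case: (ltngtP j j') => [lt_j | lt_j | Ej].
- by have := lt _ _ _ i' (ltn_ord i) lt_j; rewrite E ltnn.
- by have := lt _ _ _ i (ltn_ord i') lt_j; rewrite E ltnn.
- move/eqP: E; rewrite Ej eqn_pmul2l ?expn_gt0 // eqn_add2l => /eqP Ei.
  by congr pair; apply: val_inj.
Qed.

(** Multiplying by [3 ^ K.+1] turns the set into the integers of
    [folner_integers_inj], all too small to be identified modulo [2 ^ n]. *)
Lemma card_folner_set (n c K N : nat) :
  3 ^ K.+1 * c = 1 %[mod 2 ^ n] -> 3 ^ K.+1 * (2 * N) <= 2 ^ n ->
  #|folner_set n c K N| = K.+1 * N.
Proof.
move=> Ec le_n; rewrite card_imset ?card_prod ?card_ord //.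
move=> p p' /vert_eqP; rewrite /folner_value => E; apply: folner_integers_inj.
have lt (x : 'I_K.+1 * 'I_N) : 3 ^ x.1 * (N + x.2) < 2 ^ n.
  apply: leq_trans le_n; apply: (@leq_trans (3 ^ x.1 * (2 * N))).
    by rewrite ltn_pmul2l ?expn_gt0 //; have := ltn_ord x.2; lia.
  by rewrite leq_mul2r leq_exp2l // ltnW // orbT.
rewrite /= -[LHS](modn_small (lt p)) -[RHS](modn_small (lt p')).
rewrite -[in LHS](mul1n (_ * _)) -[in RHS](mul1n (3 ^ p'.1 * _)).
rewrite -modnMml -[in RHS]modnMml -Ec !modnMml -!mulnA.
by rewrite -modnMmr E modnMmr.
Qed.

(** Since [q = q * 3 ^ K.+1 * c] modulo [2 ^ n], the move takes [(j, i)] to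
    [(j + 1, i + q * 3 ^ (K - j))]. *)
Lemma folner_set_step (n c K N : nat) (p : 'I_K.+1 * 'I_N) (q : 'I_3) :
  3 ^ K.+1 * c = 1 %[mod 2 ^ n] -> p.1 < K -> p.2 + 2 * 3 ^ K < N ->
  vert n (3 * folner_value c p + q) \in folner_set n c K N.
Proof.
case: p => j i /= Ec lt_j le_i.
have lt_j' : j.+1 < K.+1 by [].
have lt_i' : i + q * 3 ^ (K - j) < N.
  apply: leq_ltn_trans le_i; rewrite leq_add2l leq_mul ?leq_exp2l ?leq_subr //.
  by rewrite -ltnS.
apply/imsetP; exists (Ordinal lt_j', Ordinal lt_i') => //.
apply/vert_eqP; rewrite /folner_value /=.
rewrite -[in LHS](muln1 q) -modnDmr -modnMmr -Ec modnMmr modnDmr.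
congr (_ %% _).
have -> : 3 ^ K.+1 = 3 ^ j.+1 * 3 ^ (K - j) by rewrite -expnD; congr (_ ^ _); lia.
rewrite expnS; ring.
Qed.

(** By [card_edge_boundary] it suffices to count the edges that enter the set,
    each being one of the moves [k |-> 3 k + q] reversed. The last layer accounts
    for [3 N] of them and the ends of the layers for [3 (K + 1) * 2 * 3 ^ K], which
    is again [3 N] by the choice of [N]. *)
Lemma folner_set_boundary (n c K : nat) (N := 2 * (K.+1 * 3 ^ K)) :
  3 ^ K.+1 * c = 1 %[mod 2 ^ n] ->
  #|edge_boundary (folner_set n c K N)| <= 12 * N.
Proof.
move=> Ec; rewrite card_edge_boundary (_ : 12 * N = 2 * (6 * N)); last by lia.
rewrite leq_mul2l /=.
(* Positions, together with a digit, from which a move may leave the set. *)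
pose bad : {set 'I_K.+1 * 'I_N * 'I_3} :=
  setX (setX [set ord_max] setT) setT
  :|: setX (setX setT [set i : 'I_N | N - 2 * 3 ^ K <= i]) setT.
pose g (x : 'I_K.+1 * 'I_N * 'I_3) : edge (schreier M3 n) :=
  (vert n (3 * folner_value c x.1 + x.2), x.2).
apply: (@leq_trans #|g @: bad|).
  apply/subset_leq_card/subsetP => -[s q]; rewrite inE => /andP[/= T nS].
  have [p _ Ep] := imsetP T.
  have Es : s = vert n (3 * folner_value c p + (q : 'I_3)).
    rewrite (vert_sigma q s) Ep vertK; apply/vert_eqP.
    by rewrite -modnDml modnMmr modnDml.
  apply/imsetP; exists (p, q : 'I_3); last by rewrite /g /= -Es.
  rewrite !inE /= !andbT; apply: contraR nS.
  rewrite negb_or -ltnNge => /andP[ne lt]; rewrite Es.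
  apply: folner_set_step => //; last by lia.
  by rewrite ltn_neqAle -ltnS ltn_ord andbT.
apply: leq_trans (leq_imset_card _ _) _; apply: leq_trans (leq_card_setU _ _) _.
rewrite !cardsX cards1 !cardsT !card_ord.
have -> : #|[set i : 'I_N | N - 2 * 3 ^ K <= i]| = 2 * 3 ^ K.
  rewrite -sum1dep_card -(big_geq_mkord _ _ predT (fun _ => 1)) sum_nat_const_nat.
  by rewrite muln1 subKn // /N; have := expn_gt0 3 K; nia.
rewrite /N; nia.
Qed.

Import Order.TTheory GRing.Theory Num.Theory.

Lemma not_expander (R : realType) :
  ~ expander_family R (fun n : nat => schreier M3 n.+1).
Proof.
move=> [eps eps_gt0 exp].
pose K := Num.bound (12%:R / eps)%R.
pose N := 2 * (K.+1 * 3 ^ K).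
(* Any [n] with [3 ^ K.+1 * (2 * N) <= 2 ^ n.+1] would do. *)
pose n := 3 ^ K.+1 * (2 * N).
have le_n : 3 ^ K.+1 * (2 * N) <= 2 ^ n.+1.
  by rewrite -/n ltnW // ltnW // ltn_expl.
have [c Ec] : exists c, 3 ^ K.+1 * c = 1 %[mod 2 ^ n.+1].
  have co : coprime (3 ^ K.+1) (2 ^ n.+1) by rewrite coprimeXl // coprimeXr.
  have [c d E _] := egcdnP (2 ^ n.+1) (expn_gt0 3 K.+1 : 0 < 3 ^ K.+1).
  by exists c; rewrite mulnC E (eqP co) modnMDl.
have cardS := card_folner_set Ec le_n.
have N_gt0 : 0 < N by rewrite /N !muln_gt0 expn_gt0.
have S_neq0 : folner_set n.+1 c K N != set0.
  by rewrite -card_gt0 cardS muln_gt0.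
have S_half : 2 * #|folner_set n.+1 c K N| <= #|vertex (schreier M3 n.+1)|.
  rewrite cardS card_schreier; apply: leq_trans le_n.
  by rewrite mulnCA leq_mul2r ltnW ?orbT // ltn_expl.
have: (eps * (K.+1 * N)%:R <= (12 * N)%:R :> R)%R.
  rewrite -cardS; apply: le_trans (exp n _ S_neq0 S_half) _.
  by rewrite ler_nat; apply: folner_set_boundary.
rewrite (natrM _ K.+1) (natrM _ 12) mulrA ler_pM2r ?ltr0n //.
rewrite mulrC -ler_pdivlMr //; apply/negP.
rewrite -ltNge; apply: (@lt_trans _ _ (K%:R : R)%R); last by rewrite ltr_nat.
by apply: archi_boundP; rewrite divr_ge0 ?ler0n // ltW.
Qed.

Theorem mainTheorem2 (R : realType) :
  [/\ (forall m : nat, 1 <= m ->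
        exists w : m.-tuple (state M3),
          order (@tau_tuple M3 m (ord0 : 'I_2)) w = 2 * 3 ^ (m - 1)),
      (exists C : nat, forall n : nat, 1 <= n ->
        exists2 D : nat, is_diam (schreier M3 n) D & D <= C * n ^ 2)
    & ~ expander_family R (fun n : nat => schreier M3 n.+1)].
Proof.
split; last exact: not_expander.
  by case=> // m _; rewrite subn1; apply: tau0_orbit.
exists 1 => n n_gt0; have [D HD le] := schreier_diam n.
by exists D => //; rewrite mul1n (leq_trans le) // leq_pmulr.
Qed.
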